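(* Let $\ell^{OI}$ be a line in a Desargues affine plane, with its skew field structure $(\ell^{OI},+,\cdot)$ given by addition and multiplication of points, and let $A,B,D\in\ell^{OI}$ be fixed. Let $\mathcal{R}^{C}_4=\{f_C(X)=c_r(A,B;X,D)\mid X\in\ell^{OI}\}$, where $c_r(A,B;X,D)=[(A-D)^{-1}(B-D)][(B-X)^{-1}(A-X)]$. Then for any three elements $f_C(X),f_C(Y),f_C(Z)$ of $\mathcal{R}^{C}_4$: (1) $f_C(X)\cdot[f_C(Y)+f_C(Z)]=f_C(X)\cdot f_C(Y)+f_C(X)\cdot f_C(Z)$; and (2) $[f_C(X)+f_C(Y)]\cdot f_C(Z)=f_C(X)\cdot f_C(Z)+f_C(Y)\cdot f_C(Z)$.
   Context: A Desargues affine plane is an affine plane (two distinct points lie on exactly one line; through a point $P$ not on a line $\ell$ passes exactly one line disjoint from $\ell$; there are three non-collinear points) satisfying Desargues' axiom: if $\ell^{AA'},\ell^{BB'},\ell^{CC'},\ell^{AC},\ell^{A'C'}$ are pairwise distinct lines such that $\ell^{AA'},\ell^{BB'},\ell^{CC'}$ are all parallel or all meet in one point $P$, and if $\ell^{AB}\parallel\ell^{A'B'}$, $\ell^{BC}\parallel\ell^{B'C'}$, $A\ne C$, $A'\ne C'$, $\ell^{AB}\ne\ell^{A'B'}$, $\ell^{BC}\ne\ell^{B'C'}$, then $\ell^{AC}\parallel\ell^{A'C'}$. Here $\ell^{PQ}$ is the line through $P,Q$, and $\ell^{R}_{PQ}$ is the line through $R$ parallel to $\ell^{PQ}$. Fix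 a line $\ell^{OI}$ through two distinct points $O,I$. For $A,B\in\ell^{OI}$ and an auxiliary point $B_1\notin\ell^{OI}$: addition: $P_1=\ell^{B_1}_{OI}\cap\ell^{A}_{OB_1}$ and $A+B=\ell^{P_1}_{BB_1}\cap\ell^{OI}$; multiplication: $P_1=\ell^{A}_{IB_1}\cap\ell^{OB_1}$ and $A\cdot B=\ell^{P_1}_{BB_1}\cap\ell^{OI}$. It is known that $(\ell^{OI},+,\cdot)$ is a skew field (division ring) with zero $O$ and unit $I$. Cross-ratio: for four points $A,B,C,D\in\ell^{OI}$, no three of them equal, $c_r(A,B;C,D)=[(A-D)^{-1}(B-D)][(B-C)^{-1}(A-C)]$, computed in this skew field. The paper writes the cross-ratio for all $X\in\ell^{OI}$ and gives no separate convention for a value of $X$ at which an inverse of $O$ would occur. The subscript $C$ in $f_C$ and superscript $C$ in $\mathcal{R}^{C}_4$ only indicate which of the four positions is variable. *)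

(* Defs.v *)
From Stdlib Require Import List Classical ClassicalEpsilon.
Import ListNotations.

Set Implicit Arguments.
Unset Strict Implicit.

Record affine_plane := {
  point : Type;
  line : Type;
  on : point -> line -> Prop;
  unique_join : forall P Q : point, P <> Q ->
    exists! l : line, on P l /\ on Q l;
  unique_parallel : forall (P : point) (l : line), ~ on P l ->
    exists! m : line, on P m /\ ~ (exists Q : point, on Q l /\ on Q m);
  (* The three inequalities exclude the structure with one point and no line. *)
  noncollinear_points : exists A B C : point,
    A <> B /\ B <> C /\ A <> C /\
    ~ (exists l : line, on A l /\ on B l /\ on C l) }.

Arguments on {a} P l.

Lemma point_inhabited (pi : affine_plane) : inhabited (point pi).
Proof.
  destruct (noncollinear_points pi) as [A _]. exact (inhabits A).
Qed.

Lemma line_inhabited (pi : affine_plane) : inhabited (line pi).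
Proof.
  destruct (noncollinear_points pi) as [A [B [C [hAB _]]]].
  destruct (unique_join hAB) as [l _]. exact (inhabits l).
Qed.

Section Plane.
Variable pi : affine_plane.
Implicit Types (A B C D P Q R X : point pi) (l m : line pi).

(* A line is parallel to itself. *)
Definition parallel l m : Prop := l = m \/ ~ (exists P, on P l /\ on P m).

(* Meaningful for P <> Q only. *)
Definition join P Q : line pi :=
  epsilon (line_inhabited pi) (fun l => on P l /\ on Q l).

Definition parallel_through R l : line pi :=
  epsilon (line_inhabited pi) (fun m => on R m /\ parallel l m).

(* Meaningful for non-parallel lines only. *)
Definition meet l m : point pi :=
  epsilon (point_inhabited pi) (fun P => on P l /\ on P m).

(* The inequalities between points make every line named in the axiom
   well defined. *)
Definition desarguesian : Prop :=
  forall A B C A' B' C' : point pi,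
    A <> A' -> B <> B' -> C <> C' ->
    A <> B -> A' <> B' -> B <> C -> B' <> C' -> A <> C -> A' <> C' ->
    NoDup [join A A'; join B B'; join C C'; join A C; join A' C'] ->
    (parallel (join A A') (join B B') /\ parallel (join B B') (join C C') /\
     parallel (join A A') (join C C'))
    \/ (exists P, on P (join A A') /\ on P (join B B') /\ on P (join C C')) ->
    parallel (join A B) (join A' B') ->
    parallel (join B C) (join B' C') ->
    join A B <> join A' B' -> join B C <> join B' C' ->
    parallel (join A C) (join A' C').

Section Line.
Variables O I : point pi.

Definition add_via (B1 A B : point pi) : point pi :=
  let P1 := meet (parallel_through B1 (join O I))
                 (parallel_through A (join O B1)) in
  meet (parallel_through P1 (join B B1)) (join O I).

Definition mul_via (B1 A B : point pi) : point pi :=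
  let P1 := meet (parallel_through A (join I B1)) (join O B1) in
  meet (parallel_through P1 (join B B1)) (join O I).

(* In a Desargues plane the constructed point does not depend on the auxiliary
   point B1; here B1 may be any point off the line, possibly a different one
   for each pair of arguments. *)
Definition add A B : point pi :=
  epsilon (point_inhabited pi)
    (fun S => exists B1, ~ on B1 (join O I) /\ S = add_via B1 A B).

Definition mul A B : point pi :=
  epsilon (point_inhabited pi)
    (fun S => exists B1, ~ on B1 (join O I) /\ S = mul_via B1 A B).

Definition opp A : point pi :=
  epsilon (point_inhabited pi) (fun N => on N (join O I) /\ add A N = O).

Definition sub A B : point pi := add A (opp B).

(* The parameter w is the value given to the inverse of the zero O. *)
Definition inv (w A : point pi) : point pi :=
  if excluded_middle_informative (A = O) then w
  else epsilon (point_inhabited pi)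
         (fun V => on V (join O I) /\ mul V A = I /\ mul A V = I).

Definition cross_ratio (w A B C D : point pi) : point pi :=
  mul (mul (inv w (sub A D)) (sub B D)) (mul (inv w (sub B C)) (sub A C)).

Definition f_C (w A B D X : point pi) : point pi := cross_ratio w A B X D.

Definition R4_C (w A B D : point pi) : point pi -> Prop :=
  fun p => exists X, on X (join O I) /\ p = f_C w A B D X.

End Line.
End Plane.

(* Main.v *)
From Stdlib Require Import Classical ClassicalEpsilon IndefiniteDescription.
Require Import Defs.

(** By Desargues' axiom, for points [P], [Q] on a line of a pencil (the lines of
    a direction, or the lines through [O]) some dilation of the plane preserves
    the lines of the pencil and maps [P] to [Q]; a dilation is determined by its
    values at two points.  If [t_A] is the translation with [O |-> A] and [s_A]
    the homothety with centre [O] and [I |-> A], then the constructions read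
    [A + B = t_A B] and [A * B = s_A B] for every auxiliary point.  Left
    distributivity is [s_A t_B = t_(s_A B) s_A].  For right distributivity, the
    map [X |-> t_(s_A X) (s_B X)] is a dilation because translations commute,
    and it fixes [O] and maps [I] to [A + B], so it is [s_(A+B)].  The values of
    [f_C] lie on the line whatever the inverse of [O] is, because the last step
    of each product is a meet with that line. *)

(** * Incidence and parallelism in an affine plane *)

Section Incidence.
Variable pi : affine_plane.
Implicit Types (A B C D P Q R X Y Z U V W : point pi) (l m n k : line pi).

Lemma line_eq P Q l m :
  P <> Q -> on P l -> on Q l -> on P m -> on Q m -> l = m.
Proof.
  intros H ? ? ? ?. destruct (unique_join H) as [k [_ U]].
  transitivity k; [symmetry|]; apply U; auto.
Qed.

Lemma point_eq P Q l m :
  l <> m -> on P l -> on Q l -> on P m -> on Q m -> P = Q.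
Proof. intros H ? ? ? ?. apply NNPP; intro N. apply H. eapply line_eq; eauto. Qed.

Lemma join_on P Q : P <> Q -> on P (join P Q) /\ on Q (join P Q).
Proof.
  intro H. unfold join. apply epsilon_spec.
  destruct (unique_join H) as [l [Hl _]]. eauto.
Qed.

Lemma join_eq P Q l : P <> Q -> on P l -> on Q l -> join P Q = l.
Proof. intros H ? ?. destruct (join_on P Q H). eapply line_eq; eauto. Qed.

Lemma join_comm P Q : P <> Q -> join P Q = join Q P.
Proof. intro H. destruct (join_on Q P); auto. apply join_eq; auto. Qed.

(** Includes [P = Q], where the noncollinear triple supplies a second point; later arguments need no
    case split on coinciding points. *)
Lemma line_through P Q : exists l, on P l /\ on Q l.
Proof.
  assert (E : exists R, P <> R).
  { apply NNPP; intro N. destruct (noncollinear_points pi) as (A & B & C & H & _).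
    apply H. transitivity P; [symmetry|]; apply NNPP; intro; eauto. }
  destruct E as [R E]. destruct (classic (P = Q)) as [<-|H].
  - exists (join P R). destruct (join_on P R); auto.
  - exists (join P Q). apply join_on; auto.
Qed.

Lemma point_off_line l : exists P, ~ on P l.
Proof.
  destruct (noncollinear_points pi) as (A & B & C & _ & _ & _ & H).
  apply NNPP; intro N. apply H. exists l.
  repeat split; apply NNPP; intro; eauto.
Qed.

Lemma parallel_refl l : parallel l l.
Proof. left; reflexivity. Qed.

Lemma parallel_sym l m : parallel l m -> parallel m l.
Proof. intros [->|H]; [left; auto|right]. intros (P & ? & ?). eauto. Qed.

Lemma parallel_on_eq l m P : parallel l m -> on P l -> on P m -> l = m.
Proof. intros [->|H] ? ?; auto. exfalso; eauto. Qed.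

(** A common point of [l] and [n] off [m] forces [l = n], since only one parallel to [m] passes
    through it. *)
Lemma parallel_trans l m n : parallel l m -> parallel m n -> parallel l n.
Proof.
  intros [->|H1] [<-|H2]; try (left; reflexivity); try (right; assumption).
  destruct (classic (exists P, on P l /\ on P n)) as [(P & Pl & Pn)|N]; [left|right; auto].
  assert (Pm : ~ on P m) by eauto.
  destruct (unique_parallel Pm) as [k [_ U]].
  transitivity k; [symmetry|]; apply U; split; auto.
  intros (Q & ? & ?); eauto.
Qed.

Lemma parallel_common_l k l m : parallel k l -> parallel k m -> parallel l m.
Proof. intros. apply parallel_trans with k; auto. apply parallel_sym; auto. Qed.

Lemma parallel_common_r k l m : parallel l k -> parallel m k -> parallel l m.
Proof. intros. apply parallel_trans with k; auto. apply parallel_sym; auto. Qed.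

Lemma parallel_exists R l : exists m, on R m /\ parallel l m.
Proof.
  destruct (classic (on R l)) as [H|H].
  - exists l; split; auto. apply parallel_refl.
  - destruct (unique_parallel H) as [m [[? ?] _]]. exists m; split; auto. right; auto.
Qed.

Lemma parallel_through_spec R l :
  on R (parallel_through R l) /\ parallel l (parallel_through R l).
Proof. unfold parallel_through. apply epsilon_spec. apply parallel_exists. Qed.

Lemma meet_spec l m : ~ parallel l m -> on (meet l m) l /\ on (meet l m) m.
Proof.
  intro H. unfold meet. apply epsilon_spec. apply NNPP; intro N.
  apply H. right; auto.
Qed.

Lemma meet_eq l m P : ~ parallel l m -> on P l -> on P m -> meet l m = P.
Proof.
  intros H ? ?. destruct (meet_spec l m H).
  apply (point_eq _ _ l m); auto. intro E. apply H. left; auto.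
Qed.

Lemma not_parallel_transport l m l' m' :
  ~ parallel l m -> parallel l l' -> parallel m m' -> ~ parallel l' m'.
Proof.
  intros H ? ? N. apply H. eapply parallel_trans; eauto.
  eapply parallel_common_r; eauto.
Qed.

Lemma not_parallel_join P Q l : on P l -> ~ on Q l -> ~ parallel (join P Q) l.
Proof.
  intros HP HQ N. assert (P <> Q) by congruence.
  destruct (join_on P Q); auto.
  apply HQ. rewrite <- (parallel_on_eq _ _ P N); auto.
Qed.

(** * Pencils of lines *)

(* [T] is a pencil of lines, either a parallel class or all lines through a
   point, and [V] the points that lie on exactly one line of [T]. *)
Record pencil (T : line pi -> Prop) (V : point pi -> Prop) : Prop := {
  pencil_cover : forall X, exists l, T l /\ on X l;
  pencil_unique : forall X l m, V X -> T l -> T m -> on X l -> on X m -> l = m;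
  pencil_center : forall X l, ~ V X -> T l <-> on X l;
  pencil_concurrent : forall l m n, T l -> T m -> T n ->
    (parallel l m /\ parallel m n /\ parallel l n)
    \/ (exists P, on P l /\ on P m /\ on P n) }.

Lemma parallel_pencil k : pencil (parallel k) (fun _ => True).
Proof.
  split.
  - intro X. destruct (parallel_exists X k) as (l & ? & ?); eauto.
  - intros X l m _ ? ? ? ?. apply (@parallel_on_eq _ _ X); auto.
    eapply parallel_common_l; eauto.
  - intros X l H; exfalso; apply H; exact Logic.I.
  - intros l m n ? ? ?. left; repeat split;
      (eapply parallel_common_l; eauto).
Qed.

Lemma central_pencil P : pencil (on P) (fun X => X <> P).
Proof.
  split.
  - intro X. destruct (line_through P X) as (l & ? & ?); eauto.
  - intros X l m ? ? ? ? ?. apply (line_eq X P); auto.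
  - intros X l H. apply NNPP in H; subst; tauto.
  - intros l m n ? ? ?. right; eauto.
Qed.

(* Stated for all lines through [X] and [Y], so that it is meaningful for
   [X = Y]; constant maps are dilations. *)
Definition dilation (d : point pi -> point pi) : Prop :=
  forall X Y l, on X l -> on Y l ->
    exists m, parallel l m /\ on (d X) m /\ on (d Y) m.

(** * Dilations along a pencil, from Desargues' axiom *)

Section Collineation.
Hypothesis hpi : desarguesian pi.
Variables (T : line pi -> Prop) (V : point pi -> Prop).
Hypothesis hT : pencil T V.

Lemma pencil_neq A B a b :
  T a -> T b -> V A -> on A a -> on B b -> a <> b -> A <> B.
Proof. intros ? ? ? ? ? N ->. apply N. eapply (pencil_unique _ _ hT); eauto. Qed.

Lemma pencil_off A a b : T a -> T b -> V A -> on A a -> a <> b -> ~ on A b.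
Proof. intros ? ? ? ? N ?. apply N. eapply (pencil_unique _ _ hT); eauto. Qed.

(** A common line would contain [A] and [A'], hence be [a], and [B] would lie on both [a] and
    [b]. *)
Lemma join_transversal_eq A A' B B' a b :
  T a -> T b -> a <> b -> V A -> V A' -> V B ->
  on A a -> on A' a -> on B b -> on B' b ->
  A <> A' -> join A B <> join A' B'.
Proof.
  intros Ta Tb ab VA VA' VB ? ? ? ? N E.
  assert (A <> B) by (eapply pencil_neq; [exact Ta|exact Tb|..]; eauto).
  assert (A' <> B') by (eapply pencil_neq; [exact Ta|exact Tb|..]; eauto).
  destruct (join_on A B); auto. destruct (join_on A' B'); auto.
  assert (join A B = a) by (apply (line_eq A A'); auto; congruence).
  apply (pencil_off B b a); auto. congruence.
Qed.

Lemma transversal_moves A A' B B' a b :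
  T a -> T b -> a <> b -> V A -> V A' -> V B ->
  on A a -> on A' a -> on B b -> on B' b ->
  A <> A' -> parallel (join A B) (join A' B') -> B <> B'.
Proof.
  intros Ta Tb ab VA VA' VB ? ? ? ? N E <-.
  apply (join_transversal_eq A A' B B a b); auto.
  assert (A <> B) by (eapply pencil_neq; [exact Ta|exact Tb|..]; eauto).
  assert (A' <> B) by (eapply pencil_neq; [exact Ta|exact Tb|..]; eauto).
  destruct (join_on A B); auto. destruct (join_on A' B); auto.
  eapply parallel_on_eq; eauto.
Qed.

(** Desargues' axiom with its side conditions discharged: [B <> B'] spreads to the other two pairs
    along the parallel sides, and a transversal joining points of [V] on different pencil lines is
    itself outside the pencil. *)
Lemma pencil_desargues A A' B B' C C' a b c :
  T a -> T b -> T c -> a <> b -> b <> c -> a <> c ->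
  V A -> V A' -> V B -> V B' -> V C -> V C' ->
  on A a -> on A' a -> on B b -> on B' b -> on C c -> on C' c ->
  B <> B' ->
  parallel (join A B) (join A' B') -> parallel (join B C) (join B' C') ->
  parallel (join A C) (join A' C').
Proof.
  intros Ta Tb Tc ab bc ac VA VA' VB VB' VC VC' Aa A'a Bb B'b Cc C'c BB' P1 P2.
  assert (AB : A <> B) by (apply (pencil_neq A B a b); auto).
  assert (AB' : A' <> B') by (apply (pencil_neq A' B' a b); auto).
  assert (BC : B <> C) by (apply (pencil_neq B C b c); auto).
  assert (BC' : B' <> C') by (apply (pencil_neq B' C' b c); auto).
  assert (AC : A <> C) by (apply (pencil_neq A C a c); auto).
  assert (AC' : A' <> C') by (apply (pencil_neq A' C' a c); auto).
  assert (CC' : C <> C') by (apply (transversal_moves B B' C C' b c); auto).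
  assert (AA' : A <> A').
  { apply (transversal_moves B B' A A' b a); auto.
    rewrite (join_comm B A), (join_comm B' A'); auto. }
  assert (Ja : join A A' = a) by (apply join_eq; auto).
  assert (Jb : join B B' = b) by (apply join_eq; auto).
  assert (Jc : join C C' = c) by (apply join_eq; auto).
  destruct (join_on A C) as [j1 j2]; auto.
  destruct (join_on A' C') as [j3 j4]; auto.
  apply (hpi A B C A' B' C'); auto.
  - rewrite Ja, Jb, Jc.
    assert (E : join A C <> join A' C')
      by (apply (join_transversal_eq A A' C C' a c); auto).
    assert (a <> join A C)
      by (intros ->; apply (pencil_off C c (join A C)); auto).
    assert (a <> join A' C')
      by (intros ->; apply (pencil_off C' c (join A' C')); auto).
    assert (b <> join A C)
      by (intros ->; apply (pencil_off A a (join A C)); auto).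
    assert (b <> join A' C')
      by (intros ->; apply (pencil_off A' a (join A' C')); auto).
    assert (c <> join A C)
      by (intros ->; apply (pencil_off A a (join A C)); auto).
    assert (c <> join A' C')
      by (intros ->; apply (pencil_off A' a (join A' C')); auto).
    repeat constructor; simpl; intuition congruence.
  - rewrite Ja, Jb, Jc. apply (pencil_concurrent _ _ hT); auto.
  - apply (join_transversal_eq A A' B B' a b); auto.
  - apply (join_transversal_eq B B' C C' b c); auto.
Qed.

(** [B'] is the meet of [b] with the parallel to [AB] through [A']. It is in [V], since all lines
    through a point outside [V] belong to the pencil and this parallel does not. *)
Lemma transversal_image_exists A A' B a b :
  T a -> T b -> a <> b -> V A -> V A' -> V B ->
  on A a -> on A' a -> on B b ->
  exists B', V B' /\ on B' b /\ parallel (join A B) (join A' B').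
Proof.
  intros Ta Tb ab VA VA' VB Aa A'a Bb.
  assert (AB : A <> B) by (apply (pencil_neq A B a b); auto).
  destruct (join_on A B) as [j1 j2]; auto.
  destruct (parallel_exists A' (join A B)) as (m & A'm & par).
  assert (Nb : ~ parallel (join A B) b).
  { intro N. apply (pencil_off A a b); auto.
    rewrite <- (parallel_on_eq _ _ B N); auto. }
  assert (Nm : ~ parallel m b)
    by (eapply not_parallel_transport; eauto; apply parallel_refl).
  destruct (meet_spec _ _ Nm) as [Bm Bb']. set (B' := meet m b) in *.
  assert (Tm : ~ T m).
  { intro Tm. assert (m = a) by (apply (pencil_unique _ _ hT A'); auto). subst m.
    apply (pencil_off B b a); auto. rewrite <- (parallel_on_eq _ _ A par); auto. }
  assert (VB' : V B').
  { apply NNPP; intro N. apply Tm. apply (pencil_center _ _ hT B'); auto. }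
  exists B'; repeat split; auto. rewrite (join_eq A' B' m); auto.
  apply (pencil_neq A' B' a b); auto.
Qed.

Lemma transversal_image_unique A A' B B1 B2 a b :
  T a -> T b -> a <> b -> V A -> V A' -> V B -> V B1 -> V B2 ->
  on A a -> on A' a -> on B b -> on B1 b -> on B2 b ->
  parallel (join A B) (join A' B1) -> parallel (join A B) (join A' B2) ->
  B1 = B2.
Proof.
  intros Ta Tb ab VA VA' VB VB1 VB2 Aa A'a Bb B1b B2b P1 P2.
  assert (A' <> B1) by (apply (pencil_neq A' B1 a b); auto).
  assert (A' <> B2) by (apply (pencil_neq A' B2 a b); auto).
  destruct (join_on A' B1) as [j1 j2]; auto.
  destruct (join_on A' B2) as [j3 j4]; auto.
  assert (E : join A' B1 = join A' B2).
  { apply (@parallel_on_eq _ _ A'); auto.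
    eapply parallel_common_l; eauto. }
  apply (point_eq _ _ b (join A' B1)); auto; try congruence.
  intro N. apply (pencil_off A' a b); auto. rewrite N; auto.
Qed.

Variables (P Q : point pi) (a : line pi).
Hypotheses (PQ : P <> Q) (VP : V P) (VQ : V Q) (Ta : T a) (Pa : on P a) (Qa : on Q a).

(** Each point of [V] slides along its own pencil line, to the place prescribed by one given pair of
    points. That joins stay parallel is Desargues' axiom with a suitable pair in the middle. *)
Lemma pencil_collineation_exists : exists d : point pi -> point pi,
  d P = Q /\ (forall X, ~ V X -> d X = X) /\
  (forall X x, T x -> on X x -> on (d X) x) /\
  (forall X Y x y, T x -> T y -> x <> y -> V X -> V Y -> on X x -> on Y y ->
     d X <> d Y /\ parallel (join X Y) (join (d X) (d Y))).
Proof.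
  destruct (point_off_line a) as [R Ra].
  assert (VR : V R).
  { apply NNPP; intro N. apply Ra. apply (pencil_center _ _ hT R); auto. }
  destruct (pencil_cover _ _ hT R) as (b & Tb & Rb).
  assert (ab : a <> b) by congruence.
  destruct (transversal_image_exists P Q R a b) as (R' & VR' & R'b & PR); auto.
  assert (RR' : R <> R') by (apply (transversal_moves P Q R R' a b); auto).
  (* Points off [a] are moved by means of the pair (P, Q), points on [a] by
     means of the pair (R, R'). *)
  destruct (functional_choice (fun X X' =>
     (~ V X -> X' = X) /\
     (V X -> V X' /\ (forall x, T x -> on X x -> on X' x) /\
        (~ on X a -> parallel (join P X) (join Q X')) /\
        (on X a -> parallel (join R X) (join R' X'))))) as [d Hd].
  { intro X. destruct (classic (V X)) as [VX|VX]; [|exists X; tauto].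
    destruct (pencil_cover _ _ hT X) as (x & Tx & Xx).
    assert (Ux : forall y, T y -> on X y -> y = x)
      by (intros; apply (pencil_unique _ _ hT X); auto).
    destruct (classic (on X a)) as [Xa|Xa].
    - assert (a = x) by auto. subst x.
      destruct (transversal_image_exists R R' X b a) as (X' & ? & ? & ?); auto.
      exists X'. split; [tauto|]. intros _. repeat split; try tauto.
      intros y ? ?. rewrite (Ux y); auto.
    - destruct (transversal_image_exists P Q X a x) as (X' & ? & ? & ?); auto.
      congruence.
      exists X'. split; [tauto|]. intros _. repeat split; try tauto.
      intros y ? ?. rewrite (Ux y); auto. }
  assert (dV : forall X, V X -> V (d X)) by (intros X VX; apply Hd; auto).
  assert (dT : forall X x, V X -> T x -> on X x -> on (d X) x)
    by (intros X x VX; apply Hd; auto).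
  assert (dP : forall X, V X -> ~ on X a -> parallel (join P X) (join Q (d X)))
    by (intros X VX; apply Hd; auto).
  assert (dR : forall X, V X -> on X a -> parallel (join R X) (join R' (d X)))
    by (intros X VX; apply Hd; auto).
  assert (EP : d P = Q).
  { apply (transversal_image_unique R R' P (d P) Q b a); auto.
    rewrite (join_comm R P), (join_comm R' Q); auto.
    apply not_eq_sym, (pencil_neq Q R' a b); auto. congruence. }
  assert (ER : d R = R').
  { apply (transversal_image_unique P Q R (d R) R' a b); auto. }
  assert (dmove : forall X, V X -> d X <> X).
  { intros X VX. apply not_eq_sym. destruct (classic (on X a)) as [Xa|Xa].
    - apply (transversal_moves R R' X (d X) b a); auto.
    - destruct (pencil_cover _ _ hT X) as (x & Tx & Xx).
      apply (transversal_moves P Q X (d X) a x); auto. congruence. }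
  (* Middle pair [(P, Q)], on the line [a]. *)
  assert (off_off : forall X Y x y, T x -> T y -> x <> y -> V X -> V Y ->
    on X x -> on Y y -> ~ on X a -> ~ on Y a ->
    parallel (join X Y) (join (d X) (d Y))).
  { intros X Y x y Tx Ty xy VX VY Xx Yy Xa Ya.
    assert (a <> x) by congruence. assert (a <> y) by congruence.
    apply (pencil_desargues X (d X) P Q Y (d Y) x a y); auto.
    rewrite (join_comm X P), (join_comm (d X) Q); auto; [|congruence].
    apply (pencil_neq (d X) Q x a); auto. }
  (* Middle pair [(R, R')], on the line [b]; this is why [y] must differ from [b]. *)
  assert (on_off_far : forall X Y y, T y -> y <> b -> V X -> V Y ->
    on X a -> on Y y -> ~ on Y a -> parallel (join X Y) (join (d X) (d Y))).
  { intros X Y y Ty yb VX VY Xa Yy Ya.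
    assert (a <> y) by congruence.
    apply (pencil_desargues X (d X) R R' Y (d Y) a b y); auto.
    - rewrite (join_comm X R), (join_comm (d X) R'); auto; [|congruence].
      apply (pencil_neq (d X) R' a b); auto.
    - rewrite <- ER. apply (off_off R Y b y); auto. }
  (* For [Y] on [b], a point [S] off both [a] and [b] provides the middle pair [(S, d S)] and
     reduces to the two preceding cases. *)
  assert (on_off : forall X Y y, T y -> V X -> V Y ->
    on X a -> on Y y -> ~ on Y a -> parallel (join X Y) (join (d X) (d Y))).
  { intros X Y y Ty VX VY Xa Yy Ya.
    destruct (classic (y = b)) as [->|yb]; [|apply (on_off_far X Y y); auto].
    destruct (classic (exists S, V S /\ ~ on S a /\ ~ on S b)) as [(S & VS & Sa & Sb)|N].
    - destruct (pencil_cover _ _ hT S) as (s & Ts & Ss).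
      assert (a <> s) by congruence. assert (b <> s) by congruence.
      apply (pencil_desargues X (d X) S (d S) Y (d Y) a s b); auto.
      + apply not_eq_sym; auto.
      + apply (on_off_far X S s); auto.
      + apply (off_off S Y s b); auto.
    - (* Only two lines in the pencil (as for a parallel class in the plane of
         order 2): a common point of XY and its image would be a fixed point. *)
      assert (XY : X <> Y) by congruence.
      assert (XY' : d X <> d Y) by (apply (pencil_neq (d X) (d Y) a b); auto).
      destruct (join_on X Y) as [j1 j2]; auto.
      destruct (join_on (d X) (d Y)) as [j3 j4]; auto.
      right. intros (Z & Z1 & Z2).
      assert (VZ : V Z).
      { apply NNPP; intro VZ. assert (TJ : T (join X Y))
          by (apply (pencil_center _ _ hT Z); auto).
        apply Ya. rewrite (pencil_unique _ _ hT X a (join X Y)); auto. }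
      assert (Na : join X Y <> a) by congruence.
      assert (Nb : join X Y <> b)
        by (intro E; apply (pencil_off X a b); auto; congruence).
      assert (Ya' : ~ on (d Y) a) by (apply (pencil_off (d Y) b a); auto).
      assert (Xb' : ~ on (d X) b) by (apply (pencil_off (d X) a b); auto).
      assert (Na' : join (d X) (d Y) <> a) by congruence.
      assert (Nb' : join (d X) (d Y) <> b) by congruence.
      destruct (classic (on Z a)) as [Za|Za].
      + apply (dmove X VX). transitivity Z.
        * apply (point_eq _ _ _ _ Na'); auto.
        * apply (point_eq _ _ _ _ Na); auto.
      + assert (Zb : on Z b) by (apply NNPP; intro; apply N; eauto).
        apply (dmove Y VY). transitivity Z.
        * apply (point_eq _ _ _ _ Nb'); auto.
        * apply (point_eq _ _ _ _ Nb); auto. }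
  exists d. split; [exact EP|]. split; [intros; apply Hd; auto|]. split.
  - intros X x Tx Xx. destruct (classic (V X)) as [VX|VX]; auto.
    rewrite (proj1 (Hd X)); auto.
  - intros X Y x y Tx Ty xy VX VY Xx Yy.
    assert (XY' : d X <> d Y) by (apply (pencil_neq (d X) (d Y) x y); auto).
    assert (XY : X <> Y) by (apply (pencil_neq X Y x y); auto).
    split; auto.
    destruct (classic (on X a)) as [Xa|Xa].
    + assert (x = a) by (apply (pencil_unique _ _ hT X); auto). subst x.
      apply (on_off X Y y); auto. apply (pencil_off Y y a); auto.
    + destruct (classic (on Y a)) as [Ya|Ya]; [|eauto].
      rewrite (join_comm X Y), (join_comm (d X) (d Y)); auto.
      eapply (on_off Y X x); eauto.
Qed.

(** A line of the pencil is mapped into itself. Any other line lies within [V], and distinct points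
    of it are on distinct pencil lines, so the parallelism already proved applies. *)
Lemma pencil_dilation_exists : exists d : point pi -> point pi,
  d P = Q /\ dilation d /\ (forall X, ~ V X -> d X = X) /\
  (forall X x, T x -> on X x -> on (d X) x).
Proof.
  destruct pencil_collineation_exists as (d & dP & dV & dT & dpar).
  exists d; repeat split; auto.
  intros X Y l Xl Yl.
  destruct (classic (T l)) as [Tl|Tl].
  { exists l; repeat split; auto. apply parallel_refl. }
  assert (Vl : forall Z, on Z l -> V Z).
  { intros Z Zl. apply NNPP; intro VZ. apply Tl. apply (pencil_center _ _ hT Z); auto. }
  destruct (classic (X = Y)) as [<-|XY].
  { destruct (parallel_exists (d X) l) as (m & ? & ?). eauto. }
  destruct (pencil_cover _ _ hT X) as (x & Tx & Xx).
  destruct (pencil_cover _ _ hT Y) as (y & Ty & Yy).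
  destruct (dpar X Y x y) as [N par]; auto.
  { intros <-. apply Tl. rewrite (line_eq X Y l x); auto. }
  exists (join (d X) (d Y)). rewrite (join_eq X Y l) in par; auto.
  split; auto. apply join_on; auto.
Qed.

End Collineation.

(** * Composition of dilations and their determination by two values *)

Lemma dilation_on d X Y l m :
  dilation d -> on X l -> on Y l -> parallel l m -> on (d X) m -> on (d Y) m.
Proof.
  intros Hd Xl Yl lm Xm. destruct (Hd X Y l Xl Yl) as (m' & lm' & ? & ?).
  replace m with m'; auto. apply (@parallel_on_eq _ _ (d X)); auto.
  eapply parallel_common_l; eauto.
Qed.

Lemma dilation_id : dilation (fun X => X).
Proof. intros X Y l ? ?. exists l; repeat split; auto. apply parallel_refl. Qed.

Lemma dilation_const P : dilation (fun _ => P).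
Proof. intros X Y l _ _. destruct (parallel_exists P l) as (m & ? & ?); eauto. Qed.

Lemma dilation_comp d e : dilation d -> dilation e -> dilation (fun X => d (e X)).
Proof.
  intros Hd He X Y l Xl Yl. destruct (He X Y l Xl Yl) as (m & lm & Xm & Ym).
  destruct (Hd (e X) (e Y) m Xm Ym) as (n & mn & Xn & Yn).
  exists n; repeat split; auto. eapply parallel_trans; eauto.
Qed.

Lemma dilation_fixed_on d P X l :
  dilation d -> d P = P -> on P l -> on X l -> on (d X) l.
Proof.
  intros Hd dP Pl Xl. apply (dilation_on d P X l); auto; [apply parallel_refl|].
  rewrite dP; auto.
Qed.

(** The image of [R] is the meet of the parallel to [PR] through [d P] with the parallel to [QR]
    through [d Q]. *)
Lemma dilation_ext_off d e P Q R l :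
  dilation d -> dilation e -> P <> Q -> on P l -> on Q l -> ~ on R l ->
  d P = e P -> d Q = e Q -> d R = e R.
Proof.
  intros Hd He PQ Pl Ql Rl EP EQ.
  destruct (line_through P R) as (u & Pu & Ru).
  destruct (line_through Q R) as (v & Qv & Rv).
  destruct (parallel_exists (d P) u) as (u' & Pu' & uu').
  destruct (parallel_exists (d Q) v) as (v' & Qv' & vv').
  apply (point_eq _ _ u' v').
  - intros <-. assert (E : u = v).
    { apply (@parallel_on_eq _ _ R); auto.
      eapply parallel_common_r; eauto. }
    subst v. apply Rl. rewrite (line_eq P Q l u); auto.
  - apply (dilation_on d P R u); auto.
  - apply (dilation_on e P R u); auto. congruence.
  - apply (dilation_on d Q R v); auto.
  - apply (dilation_on e Q R v); auto. congruence.
Qed.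

Lemma dilation_ext d e P Q :
  dilation d -> dilation e -> P <> Q -> d P = e P -> d Q = e Q ->
  forall X, d X = e X.
Proof.
  intros Hd He PQ EP EQ X.
  destruct (line_through P Q) as (l & Pl & Ql).
  destruct (classic (on X l)) as [Xl|Xl]; [|eapply dilation_ext_off; eauto].
  (* For [X] on [PQ], agreement is first obtained at some [R] off [PQ]; then [X] is off the line
     [PR]. *)
  destruct (point_off_line l) as (R & Rl).
  assert (ER : d R = e R) by (eapply (dilation_ext_off d e P Q); eauto).
  destruct (classic (X = P)) as [->|XP]; auto.
  destruct (line_through P R) as (m & Pm & Rm).
  apply (dilation_ext_off d e P R X m); auto; try congruence.
  intro Xm. apply Rl. rewrite (line_eq X P l m); auto.
Qed.

(** * Translations *)

(** The last clause separates translations from other dilations. For [P = Q] it ranges over all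
    lines through [P], hence over all directions, and forces the identity. *)
Definition translates P Q (d : point pi -> point pi) : Prop :=
  dilation d /\ d P = Q /\
  forall l m X, on P l -> on Q l -> parallel l m -> on X m -> on (d X) m.

Lemma translates_id P : translates P P (fun X => X).
Proof. repeat split; auto. apply dilation_id. Qed.

(** A point [Y] off [PQ] goes to the fourth vertex of a parallelogram: the meet of the parallel to
    [PQ] through [Y] with the parallel to [PY] through [Q]. *)
Lemma translates_unique P Q d e :
  translates P Q d -> translates P Q e -> forall X, d X = e X.
Proof.
  intros (Hd & dP & dT) (He & eP & eT).
  destruct (line_through P Q) as (l & Pl & Ql).
  destruct (point_off_line l) as (Y & Yl).
  destruct (line_through P Y) as (n & Pn & Yn).
  destruct (parallel_exists Y l) as (m & Ym & lm).
  destruct (parallel_exists Q n) as (n' & Qn' & nn').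
  apply (dilation_ext d e P Y); auto; try congruence.
  apply (point_eq _ _ m n').
  - intros <-. apply Yl. rewrite (@parallel_on_eq l n P); auto.
    eapply parallel_common_r; eauto.
  - apply (dT l); auto.
  - apply (eT l); auto.
  - apply (dilation_on d P Y n); auto. congruence.
  - apply (dilation_on e P Y n); auto. congruence.
Qed.

(** The composite fixes [P]. It keeps a point [Y] off [PQ] both on [PY] and on the parallel to [PQ],
    so it fixes [Y] too. *)
Lemma translates_inverse P Q d e :
  translates P Q d -> translates Q P e -> forall X, e (d X) = X.
Proof.
  intros (Hd & dP & dT) (He & eQ & eT).
  destruct (line_through P Q) as (l & Pl & Ql).
  destruct (point_off_line l) as (Y & Yl).
  destruct (line_through P Y) as (n & Pn & Yn).
  destruct (parallel_exists Y l) as (m & Ym & lm).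
  assert (Hc := dilation_comp e d He Hd).
  apply (dilation_ext (fun X => e (d X)) (fun X => X) P Y); auto; try congruence.
  - apply dilation_id.
  - apply (point_eq _ _ m n); auto.
    + intros <-. apply Yl. rewrite (parallel_on_eq _ _ P lm); auto.
    + apply (eT l); auto. apply (dT l); auto.
    + apply (dilation_fixed_on _ P Y n Hc); auto. congruence.
Qed.

(** * Existence of translations and homotheties; commuting translations *)

Hypothesis hpi : desarguesian pi.

Lemma translation_exists P Q : exists d, translates P Q d.
Proof.
  destruct (classic (P = Q)) as [<-|PQ]; [eexists; apply translates_id|].
  destruct (line_through P Q) as (l & Pl & Ql).
  destruct (pencil_dilation_exists hpi _ _ (parallel_pencil l) P Q l)
    as (d & dP & Hd & _ & dT); auto; [apply parallel_refl|].
  exists d; repeat split; auto. intros l' m X Pl' Ql' lm Xm.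
  apply dT; auto. rewrite (line_eq P Q l l'); auto.
Qed.

(** [Q = O] is allowed and gives the constant map, which serves as multiplication by zero. *)
Lemma homothety_exists O P Q l :
  O <> P -> on O l -> on P l -> on Q l ->
  exists d, dilation d /\ d O = O /\ d P = Q.
Proof.
  intros OP Ol Pl Ql.
  destruct (classic (Q = O)) as [->|QO].
  { exists (fun _ => O); repeat split. apply dilation_const. }
  destruct (classic (P = Q)) as [<-|PQ].
  { exists (fun X => X); repeat split. apply dilation_id. }
  destruct (pencil_dilation_exists hpi _ _ (central_pencil O) P Q l)
    as (d & dP & Hd & dO & _); auto.
  exists d; repeat split; auto.
Qed.

(** Both composites send [X] to the meet of the parallel to [u] through [dw X] with the parallel to
    [w] through [du X]. *)
Lemma translations_commute_transversal O U W u w du dw :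
  on O u -> on U u -> on O w -> on W w -> u <> w ->
  translates O U du -> translates O W dw -> forall X, du (dw X) = dw (du X).
Proof.
  intros Ou Uu Ow Ww uw (Hu & uO & uT) (Hw & wO & wT) X.
  destruct (parallel_exists (dw X) u) as (m & Xm & um).
  destruct (parallel_exists (du X) w) as (n & Xn & wn).
  destruct (parallel_exists X u) as (m' & Xm' & um').
  destruct (parallel_exists X w) as (n' & Xn' & wn').
  apply (point_eq _ _ m n).
  - intros <-. apply uw. apply (@parallel_on_eq _ _ O); auto.
    apply (parallel_common_r m); auto.
  - apply (uT u); auto.
  - apply (dilation_on dw X (du X) m' m Hw); auto.
    + apply (uT u); auto.
    + apply (parallel_common_l u); auto.
  - apply (dilation_on du X (dw X) n' n Hu); auto.
    + apply (wT w); auto.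
    + apply (parallel_common_l w); auto.
  - apply (wT w); auto.
Qed.

Lemma translates_comm O U W du dw :
  translates O U du -> translates O W dw -> du W = dw U.
Proof.
  intros HU HW.
  pose proof HU as (Hu & uO & uT). pose proof HW as (Hw & wO & wT).
  destruct (line_through O U) as (u & Ou & Uu).
  destruct (line_through O W) as (w & Ow & Ww).
  destruct (classic (u = w)) as [<-|uw].
  2: { rewrite <- uO, <- wO.
       apply (translations_commute_transversal O U W u w); auto. }
  destruct (classic (U = O)) as [->|UO].
  { rewrite wO. apply (translates_unique _ _ _ _ HU (translates_id O)). }
  (* Collinear case: a translation [O -> V] off the line gives
     [U + V + W = V + (U + W)] with [V], [U + V] transversal to [W]. *)
  destruct (point_off_line u) as (V & Vu).
  destruct (translation_exists O V) as (dv & HV).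
  pose proof HV as (Hv & vO & vT).
  destruct (line_through O V) as (v & Ov & Vv).
  assert (uv : u <> v) by congruence.
  assert (Cuv := translations_commute_transversal O U V u v du dv Ou Uu Ov Vv uv HU HV).
  assert (Cwv := translations_commute_transversal O W V u v dw dv Ou Ww Ov Vv uv HW HV).
  assert (ES : du V = dv U) by (rewrite <- vO, Cuv, uO; auto).
  set (S := du V) in *.
  assert (Su : ~ on S u).
  { intro Su. destruct (parallel_exists V u) as (m & Vm & um).
    apply Vu. rewrite (parallel_on_eq u m S um); auto. apply (uT u); auto. }
  (* If [S] were on [v], the parallel to [v] through [U] would be [v] itself, and [U] would be the
     meet [O] of [u] and [v]. *)
  assert (Sv : ~ on S v).
  { intro Sv. destruct (parallel_exists U v) as (m & Um & vm).
    assert (on S m) by (apply (dilation_on du O V v m Hu); auto; congruence).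
    assert (v = m) by (apply (@parallel_on_eq _ _ S); auto). subst m.
    apply UO. apply (point_eq _ _ u v); auto. }
  destruct (translation_exists O S) as (ds & HS).
  pose proof HS as (Hs & sO & sT).
  destruct (line_through O S) as (s & Os & Ss).
  assert (us : u <> s) by congruence. assert (vs : v <> s) by congruence.
  assert (Cws := translations_commute_transversal O W S u s dw ds Ou Ww Os Ss us HW HS).
  assert (Cvs := translations_commute_transversal O V S v s dv ds Ov Vv Os Ss vs HV HS).
  assert (E : forall X, ds X = dv (du X)).
  { apply (dilation_ext ds (fun X => dv (du X)) O V); auto.
    - apply dilation_comp; auto.
    - congruence.
    - congruence.
    - rewrite <- vO at 1. rewrite <- Cvs, sO. reflexivity. }
  (* After cancelling [dv] by its inverse [e], both sides become [ds W]. *)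
  destruct (translation_exists V O) as (e & He).
  assert (inv := translates_inverse _ _ _ _ HV He).
  rewrite <- (inv (du W)), <- (inv (dw U)). f_equal.
  rewrite <- E, <- Cwv, <- ES, <- sO, Cws, wO. reflexivity.
Qed.

End Incidence.

(** * Sums and products on [OI] as values of dilations *)

Section Line.
Variable pi : affine_plane.
Hypothesis hpi : desarguesian pi.
Variables O I : point pi.
Hypothesis hOI : O <> I.
Implicit Types (A B C P X Y : point pi) (s t : point pi -> point pi).
Local Notation OI := (join O I).

Lemma on_O : on O OI. Proof. apply join_on; auto. Qed.
Lemma on_I : on I OI. Proof. apply join_on; auto. Qed.
Local Hint Resolve on_O on_I : core.

(** The line is parallel to [B B1], which meets [OI] in [B] alone; so the final meet of either
    construction is a genuine point of [OI]. *)
Lemma last_step_transversal B1 B P :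
  ~ on B1 OI -> on B OI -> ~ parallel (parallel_through P (join B B1)) OI.
Proof.
  intros HB1 HB. destruct (parallel_through_spec _ P (join B B1)).
  apply (not_parallel_transport _ (join B B1) OI); auto; [|apply parallel_refl].
  apply not_parallel_join; auto.
Qed.

(** The shared end of both constructions: [s] carries the line [B B1] into its parallel through [P],
    which therefore meets [OI] in [s B]. *)
Lemma last_step B B1 P s :
  dilation pi s -> ~ on B1 OI -> on B OI -> on (s B) OI -> s B1 = P ->
  meet (parallel_through P (join B B1)) OI = s B.
Proof.
  intros Hs HB1 HB sB <-. assert (B <> B1) by congruence.
  destruct (join_on _ B B1) as [j1 j2]; auto.
  apply meet_eq; auto.
  - apply last_step_transversal; auto.
  - destruct (parallel_through_spec _ (s B1) (join B B1)).
    apply (dilation_on _ s B1 B (join B B1)); auto.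
Qed.

Lemma add_via_translation A B B1 t :
  ~ on B1 OI -> on A OI -> on B OI -> translates pi O A t ->
  add_via O I B1 A B = t B.
Proof.
  intros HB1 HA HB (Ht & tO & tT). unfold add_via.
  assert (O <> B1) by (intros <-; auto).
  destruct (join_on _ O B1) as [j1 j2]; auto.
  apply last_step; auto.
  { apply (tT OI); auto. apply parallel_refl. }
  destruct (parallel_through_spec _ B1 OI) as [p1 p2].
  destruct (parallel_through_spec _ A (join O B1)) as [q1 q2].
  (* [P1] is [t B1]: [t] preserves the parallel to [OI] through [B1] and carries [O B1] into its
     parallel through [A]. *)
  symmetry. apply meet_eq.
  - apply (not_parallel_transport _ OI (join O B1)); auto.
    intro N. apply HB1. rewrite (parallel_on_eq _ _ _ O N); auto.
  - apply (tT OI); auto.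
  - apply (dilation_on _ t O B1 (join O B1)); auto. congruence.
Qed.

Lemma mul_via_homothety A B B1 s :
  ~ on B1 OI -> on A OI -> on B OI -> dilation pi s -> s O = O -> s I = A ->
  mul_via O I B1 A B = s B.
Proof.
  intros HB1 HA HB Hs sO sI. unfold mul_via.
  assert (O <> B1) by (intros <-; auto).
  assert (I <> B1) by (intros <-; auto).
  destruct (join_on _ O B1) as [j1 j2]; auto.
  destruct (join_on _ I B1) as [k1 k2]; auto.
  apply last_step; auto.
  { apply (dilation_fixed_on _ s O); auto. }
  destruct (parallel_through_spec _ A (join I B1)) as [p1 p2].
  (* [P1] is [s B1]: [s] preserves [O B1] and carries [I B1] into its parallel through [A]. *)
  symmetry. apply meet_eq.
  - apply (not_parallel_transport _ (join I B1) (join O B1)); auto; [|apply parallel_refl].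
    intro N. apply HB1. rewrite (line_eq _ O I OI (join O B1)); auto.
    rewrite <- (parallel_on_eq _ _ _ B1 N); auto.
  - apply (dilation_on _ s I B1 (join I B1)); auto. congruence.
  - apply (dilation_fixed_on _ s O); auto.
Qed.

Lemma add_eq_via A B : exists B1, ~ on B1 OI /\ add O I A B = add_via O I B1 A B.
Proof.
  unfold add at 1. apply epsilon_spec.
  destruct (point_off_line _ OI) as (B1 & ?). eauto.
Qed.

Lemma add_translation A B t :
  on A OI -> on B OI -> translates pi O A t -> add O I A B = t B.
Proof.
  intros HA HB Ht.
  destruct (add_eq_via A B) as (B1 & ? & ->). apply add_via_translation; auto.
Qed.

Lemma mul_eq_via A B : exists B1, ~ on B1 OI /\ mul O I A B = mul_via O I B1 A B.
Proof.
  unfold mul at 1. apply epsilon_spec.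
  destruct (point_off_line _ OI) as (B1 & ?). eauto.
Qed.

Lemma mul_homothety A B s :
  on A OI -> on B OI -> dilation pi s -> s O = O -> s I = A -> mul O I A B = s B.
Proof.
  intros HA HB Hs sO sI.
  destruct (mul_eq_via A B) as (B1 & ? & ->). apply mul_via_homothety; auto.
Qed.

Lemma add_on A B : on B OI -> on (add O I A B) OI.
Proof.
  intros HB.
  destruct (add_eq_via A B) as (B1 & ? & ->). apply meet_spec, last_step_transversal; auto.
Qed.

Lemma mul_on A B : on B OI -> on (mul O I A B) OI.
Proof.
  intros HB.
  destruct (mul_eq_via A B) as (B1 & ? & ->). apply meet_spec, last_step_transversal; auto.
Qed.

Lemma opp_on C : on C OI -> on (opp O I C) OI.
Proof.
  intros HC. unfold opp.
  apply (epsilon_spec (point_inhabited pi) (fun N => on N OI /\ add O I C N = O)).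
  destruct (translation_exists _ hpi O C) as (t & Ht).
  destruct (translation_exists _ hpi C O) as (t' & Ht').
  assert (on (t' O) OI) by (apply Ht' with OI; auto; apply parallel_refl).
  (* The negative of [C] is the image of [O] under the translation from [C] to [O]. *)
  exists (t' O); split; auto.
  rewrite (add_translation C (t' O) t); auto.
  apply (translates_inverse _ C O t' t); auto.
Qed.

Lemma R4_C_on w A B D P : on A OI -> on B OI -> on D OI -> R4_C O I w A B D P -> on P OI.
Proof.
  intros HA HB HD (X & HX & ->). unfold f_C, cross_ratio, sub.
  apply mul_on, mul_on, add_on, opp_on; auto.
Qed.

(** * The two distributive laws *)

Lemma mul_add_distr_l A B C : on A OI -> on B OI -> on C OI ->
  mul O I A (add O I B C) = add O I (mul O I A B) (mul O I A C).
Proof.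
  intros HA HB HC.
  destruct (homothety_exists _ hpi O I A OI) as (s & Hs & sO & sI); auto.
  assert (s_on := fun X m => dilation_fixed_on pi s O X m Hs sO).
  destruct (translation_exists _ hpi O B) as (t & Ht & tO & tT).
  destruct (translation_exists _ hpi O (s B)) as (t' & Ht' & tO' & tT').
  rewrite (add_translation B C t), (mul_homothety A B s), (mul_homothety A C s),
    (add_translation (s B) (s C) t'), (mul_homothety A (t C) s); repeat split; auto.
  2: { apply (tT OI); auto. apply parallel_refl. }
  (* The two dilations are compared at [O] and at [X] off the line. Both images of [X] lie on the
     parallel to [OI] through [s X] and on the parallel to [OX] through [s B]. *)
  destruct (point_off_line _ OI) as (X & HX).
  apply (dilation_ext _ (fun Y => s (t Y)) (fun Y => t' (s Y)) O X);
    try (apply dilation_comp; auto); try congruence.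
  - intros <-; auto.
  - destruct (line_through _ O X) as (n & On & Xn).
    destruct (parallel_exists _ (s X) OI) as (m & Xm & pm).
    destruct (parallel_exists _ X OI) as (m' & Xm' & pm').
    destruct (parallel_exists _ (s B) n) as (n' & Bn' & pn).
    apply (point_eq _ _ _ m n').
    + intros <-. apply HX. rewrite (parallel_on_eq _ OI n O); auto.
      apply (parallel_common_r _ m); auto.
    + apply (dilation_on _ s X (t X) m'); auto; [apply (tT OI); auto|].
      apply (parallel_common_l _ OI); auto.
    + apply (tT' OI); auto.
    + apply (dilation_on _ (fun Y => s (t Y)) O X n); auto;
        [apply dilation_comp; auto|congruence].
    + apply (dilation_on _ t' O (s X) n); auto. congruence.
Qed.

Lemma mul_add_distr_r A B C : on A OI -> on B OI -> on C OI ->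
  mul O I (add O I A B) C = add O I (mul O I A C) (mul O I B C).
Proof.
  intros HA HB HC.
  destruct (homothety_exists _ hpi O I A OI) as (a & Ha & aO & aI); auto.
  destruct (homothety_exists _ hpi O I B OI) as (b & Hb & bO & bI); auto.
  destruct (functional_choice (translates pi O)) as [t Ht].
  { intro; apply translation_exists; auto. }
  assert (t_on : forall X l, on O l -> on (a X) l -> on (b X) l -> on (t (a X) (b X)) l).
  { intros X l ? ? ?. apply (Ht (a X)) with l; auto. apply parallel_refl. }
  rewrite (mul_homothety A C a), (mul_homothety B C b); auto.
  rewrite (add_translation A B (t A)); auto.
  assert (h_on := fun d => dilation_fixed_on pi d O).
  rewrite (add_translation (a C) (b C) (t (a C))); auto.
  apply (mul_homothety (t A B) C (fun X => t (a X) (b X))); auto.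
  - rewrite <- aI, <- bI. auto.
  - intros X Y l Xl Yl.
    (* From [X] to [Y] in two moves along [m']: first [a X] becomes [a Y], with the summands
       exchanged by commutativity, then [b X] becomes [b Y]. *)
    destruct (Ha X Y l) as (m & lm & Xm & Ym); auto.
    destruct (Hb X Y l) as (n & ln & Xn & Yn); auto.
    destruct (proj1 (Ht (b X)) (a X) (a Y) m) as (m' & mm' & Xm' & Ym'); auto.
    exists m'. assert (lm' : parallel l m') by (apply (parallel_trans _ l m m'); auto).
    split; auto. split.
    + rewrite (translates_comm _ hpi O (a X) (b X) _ _ (Ht _) (Ht _)). auto.
    + apply (dilation_on _ (t (a Y)) (b X) (b Y) n); auto.
      * apply Ht.
      * apply (parallel_common_l _ l); auto.
      * rewrite (translates_comm _ hpi O (a Y) (b X) _ _ (Ht _) (Ht _)). auto.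
  - rewrite aO, bO. apply Ht.
  - congruence.
Qed.

End Line.

Theorem theorem9 (pi : affine_plane) (hpi : desarguesian pi)
  (O I : point pi) (hOI : O <> I)
  (w : point pi) (hw : on w (join O I))
  (A B D : point pi)
  (hA : on A (join O I)) (hB : on B (join O I)) (hD : on D (join O I))
  (fX fY fZ : point pi)
  (hX : R4_C O I w A B D fX) (hY : R4_C O I w A B D fY)
  (hZ : R4_C O I w A B D fZ) :
  mul O I fX (add O I fY fZ) = add O I (mul O I fX fY) (mul O I fX fZ) /\
  mul O I (add O I fX fY) fZ = add O I (mul O I fX fZ) (mul O I fY fZ).
Proof.
  apply R4_C_on in hX, hY, hZ; auto.
  split; [apply mul_add_distr_l | apply mul_add_distr_r]; auto.
Qed.
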